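(* Let $A\in\mathbb{C}^{m\times n}$, $0\neq W\in\mathbb{C}^{n\times m}$ and $q\in\mathbb{N}\cup\{0\}$. Suppose that $$A=U\begin{bmatrix}A_1&A_2\\0&A_3\end{bmatrix}V^*,\qquad W=V\begin{bmatrix}W_1&W_2\\0&W_3\end{bmatrix}U^*$$ is a weighted core-EP decomposition of the pair $(A,W)$. Then $$A^{\diamond_q,W}=U\begin{bmatrix}(W_1A_1W_1)^*\Omega_W&-(W_1A_1W_1)^*\Omega_WMA_3^{\diamond_q,W_3}\\(P_{(A_3W_3)^q}-P_{A_3^{\diamond_q,W_3}})M^*\Omega_W&A_3^{\diamond_q,W_3}-(P_{(A_3W_3)^q}-P_{A_3^{\diamond_q,W_3}})M^*\Omega_WMA_3^{\diamond_q,W_3}\end{bmatrix}V^*,$$ where $$M:=W_1A_1W_2+W_1A_2W_3+W_2A_3W_3$$ and $$\Omega_W:=\bigl[W_1A_1W_1(W_1A_1W_1)^*+M(P_{(A_3W_3)^q}-P_{A_3^{\diamond_q,W_3}})M^*\bigr]^{-1}.$$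
   Context: $B^*$ is the conjugate transpose and $B^\dagger$ the Moore-Penrose inverse of $B$; $P_B:=BB^\dagger$ is the orthogonal projector onto the column space of $B$. For square $B$, $B^0=I$ and $\mathrm{Ind}(B)$ is the smallest nonnegative integer $j$ with $\mathrm{rank}(B^j)=\mathrm{rank}(B^{j+1})$. The $W$-weighted $q$-BT inverse $A^{\diamond_q,W}$ is the unique $X\in\mathbb{C}^{m\times n}$ satisfying $XWAWX=X$, $XWA=(WAWP_{(AW)^q})^\dagger WA$, $AWX=AW(WAWP_{(AW)^q})^\dagger$; explicitly $A^{\diamond_q,W}=(WAWP_{(AW)^q})^\dagger$. Correspondingly $A_3^{\diamond_q,W_3}=(W_3A_3W_3P_{(A_3W_3)^q})^\dagger$ (this formula is used also if $W_3=0$). A weighted core-EP decomposition of $(A,W)$ (which always exists, a known result) is a representation of $A$ and $W$ in the displayed form with $U\in\mathbb{C}^{m\times m}$, $V\in\mathbb{C}^{n\times n}$ unitary, $A_1,W_1\in\mathbb{C}^{t\times t}$ nonsingular, $A_3\in\mathbb{C}^{(m-t)\times(n-t)}$, $W_3\in\mathbb{C}^{(n-t)\times(m-t)}$, and $A_3W_3$, $W_3A_3$ nilpotent of indices $\mathrm{Ind}(AW)$ and $\mathrm{Ind}(WA)$, respectively. *)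

(* Defs.v *)
From HB Require Import structures.
From mathcomp Require Import all_boot all_order all_algebra.
From mathcomp Require Import spectral.
From mathcomp Require Import boolp classical_sets reals complex.

Set Implicit Arguments.
Unset Strict Implicit.
Unset Printing Implicit Defensive.

Import Order.TTheory GRing.Theory Num.Theory.
Local Open Scope ring_scope.
Local Open Scope sesquilinear_scope.
Local Open Scope classical_set_scope.

Section Defs.
Variable C : numClosedFieldType.

Definition is_mpinv m n (B : 'M[C]_(m, n)) (X : 'M[C]_(n, m)) : Prop :=
  [/\ B *m X *m B = B, X *m B *m X = X,
      (B *m X)^t* = B *m X & (X *m B)^t* = X *m B].

(* The Moore-Penrose inverse: the unique X with is_mpinv B X; existence and
   uniqueness are mpinvP and mpinv_unique below, so 0 is never returned by
   default. *)
Definition mpinv m n (B : 'M[C]_(m, n)) : 'M[C]_(n, m) :=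
  xget 0 [set X | is_mpinv B X].

Definition mpproj m n (B : 'M[C]_(m, n)) : 'M[C]_m := B *m mpinv B.

Definition is_wqBT m n (A : 'M[C]_(m, n)) (W : 'M[C]_(n, m)) (q : nat)
    (X : 'M[C]_(m, n)) : Prop :=
  let D := mpinv (W *m A *m W *m mpproj ((A *m W) ^+ q)) in
  [/\ X *m W *m A *m W *m X = X,
      X *m W *m A = D *m W *m A &
      A *m W *m X = A *m W *m D].

(* The W-weighted q-BT inverse: the unique X with is_wqBT A W q X.  By wqBTP,
   wqBT_unique and wqBTE below it always exists, also for W = 0, and equals
   (W A W P_{(AW)^q})^dagger. *)
Definition wqBT m n (A : 'M[C]_(m, n)) (W : 'M[C]_(n, m)) (q : nat) :
    'M[C]_(m, n) :=
  xget 0 [set X | is_wqBT A W q X].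

Lemma mxind_ex n (B : 'M[C]_n) :
  exists j, \rank (B ^+ j) == \rank (B ^+ j.+1).
Proof.
apply: contrapT => noj.
have lt_rk j : (\rank (B ^+ j.+1) < \rank (B ^+ j))%N.
  rewrite ltn_neqAle; apply/andP; split.
    by apply/negP => /eqP rkj; apply: noj; exists j; rewrite rkj.
  by rewrite exprS; exact: mxrankM_maxr.
have le_rk j : (\rank (B ^+ j) + j <= n)%N.
  elim: j => [|j IHj]; first by rewrite addn0 rank_leq_row.
  by rewrite addnS (leq_trans _ IHj) // -addSn leq_add2r.
by have := leq_trans (leq_addl _ _) (le_rk n.+1); rewrite ltnn.
Qed.

Definition mxind n (B : 'M[C]_n) : nat := ex_minn (mxind_ex B).

(* k ranges over all of nat, so that the 0 x 0 matrix (which is invertible, of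
   index 0) is nilpotent of index 0. *)
Definition nilpotent_of_index n (B : 'M[C]_n) (k : nat) : Prop :=
  B ^+ k = 0 /\ forall j, B ^+ j = 0 -> (k <= j)%N.

(* Here m = t + p and n = t + r. *)
Definition weighted_core_EP t p r
    (A : 'M[C]_(t + p, t + r)) (W : 'M[C]_(t + r, t + p))
    (U : 'M[C]_(t + p)) (V : 'M[C]_(t + r))
    (A1 : 'M[C]_t) (A2 : 'M[C]_(t, r)) (A3 : 'M[C]_(p, r))
    (W1 : 'M[C]_t) (W2 : 'M[C]_(t, p)) (W3 : 'M[C]_(r, p)) : Prop :=
  [/\ A = U *m block_mx A1 A2 0 A3 *m V^t*,
      W = V *m block_mx W1 W2 0 W3 *m U^t*,
      U \is unitarymx /\ V \is unitarymx,
      A1 \in unitmx /\ W1 \in unitmx &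
      nilpotent_of_index (A3 *m W3) (mxind (A *m W)) /\
      nilpotent_of_index (W3 *m A3) (mxind (W *m A))].

Lemma adjmxM m n p (A : 'M[C]_(m, n)) (B : 'M[C]_(n, p)) :
  (A *m B)^t* = B^t* *m A^t*.
Proof. by rewrite trmx_mul map_mxM. Qed.

Lemma mulmx_adj_eq0 m n (A : 'M[C]_(m, n)) : A *m A^t* = 0 -> A = 0.
Proof.
move=> AA0; apply/row_matrixP => i; rewrite row0.
apply: contrapT => /eqP/dotmx_is_dotmx; rewrite dotmxE.
have -> : row i A *m (row i A)^t* = row i (A *m A^t*) *m (delta_mx 0 i)^t*.
  by rewrite (rowE i A) adjmxM (rowE i (A *m _)) !mulmxA.
by rewrite AA0 row0 mul0mx mxE ltxx.
Qed.

Lemma row_free_gram_unit m n (G : 'M[C]_(m, n)) :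
  row_free G -> G *m G^t* \in unitmx.
Proof.
move=> freeG; rewrite -row_free_unit -kermx_eq0; apply/eqP.
set K := kermx _; have KG0 : K *m G = 0.
  by apply: mulmx_adj_eq0; rewrite adjmxM !mulmxA -(mulmxA K) mulmx_ker mul0mx.
by apply: (row_free_inj freeG); rewrite KG0 mul0mx.
Qed.

Lemma adj_invmx n (B : 'M[C]_n) : (invmx B)^t* = invmx (B^t*).
Proof. by rewrite trmx_inv map_invmx. Qed.

Lemma is_mpinv_ex m n (B : 'M[C]_(m, n)) : exists X, is_mpinv B X.
Proof.
set F := col_base B; set G := row_base B.
have BFG : B = F *m G by rewrite mulmx_base.
have uG : G *m G^t* \in unitmx.
  by apply: row_free_gram_unit; exact: row_base_free.
have uF : F^t* *m F \in unitmx.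
  have := @row_free_gram_unit _ _ (F^t*); rewrite trmxCK; apply.
  rewrite /row_free mxrank_map mxrank_tr.
  by have := col_base_full B; rewrite /row_full.
clearbody F G; rewrite {}BFG.
set HG := G *m G^t* in uG; set HF := F^t* *m F in uF.
have hG : HG^t* = HG by rewrite /HG adjmxM trmxCK.
have hF : HF^t* = HF by rewrite /HF adjmxM trmxCK.
exists (G^t* *m invmx HG *m (invmx HF *m F^t*)).
have BX : F *m G *m (G^t* *m invmx HG *m (invmx HF *m F^t*))
        = F *m invmx HF *m F^t*.
  by rewrite !mulmxA -(mulmxA F G) -/HG mulmxK.
have XB : G^t* *m invmx HG *m (invmx HF *m F^t*) *m (F *m G)
        = G^t* *m invmx HG *m G.
  by rewrite !mulmxA -(mulmxA _ (F^t*) F) -/HF mulmxKV.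
split.
- by rewrite BX !mulmxA -(mulmxA _ (F^t*) F) -/HF mulmxKV.
- by rewrite XB !mulmxA -(mulmxA _ G (G^t*)) -/HG mulmxKV.
- by rewrite BX !adjmxM trmxCK adj_invmx hF mulmxA.
- by rewrite XB !adjmxM trmxCK adj_invmx hG mulmxA.
Qed.

Lemma is_mpinv_unique m n (B : 'M[C]_(m, n)) X Y :
  is_mpinv B X -> is_mpinv B Y -> X = Y.
Proof.
move=> [BXB XBX hBX hXB] [BYB YBY hBY hYB].
have eBX : B *m X = B *m Y.
  by rewrite -hBX -{1}BYB -mulmxA adjmxM hBX hBY !mulmxA BXB.
have eXB : X *m B = Y *m B.
  have e1 : X *m B *m (Y *m B) = X *m B by rewrite -mulmxA (mulmxA B) BYB.
  have e2 : Y *m B *m (X *m B) = Y *m B by rewrite -mulmxA (mulmxA B) BXB.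
  by rewrite -e1 -{1}hXB -{1}hYB -adjmxM e2 hYB.
by rewrite -XBX eXB -mulmxA eBX mulmxA YBY.
Qed.

Lemma mpinvP m n (B : 'M[C]_(m, n)) : is_mpinv B (mpinv B).
Proof. by have := xgetPex 0 (is_mpinv_ex B). Qed.

Lemma mpinv_unique m n (B : 'M[C]_(m, n)) X : is_mpinv B X -> mpinv B = X.
Proof. by move=> hX; apply: is_mpinv_unique hX; exact: mpinvP. Qed.

Lemma is_wqBT_mpinv m n (A : 'M[C]_(m, n)) (W : 'M[C]_(n, m)) q :
  is_wqBT A W q (mpinv (W *m A *m W *m mpproj ((A *m W) ^+ q))).
Proof.
split=> //; set B := (A *m W) ^+ q; set P := mpproj B.
set N := W *m A *m W; set D := mpinv _.
have [_ DND _ hDN] := mpinvP (N *m P); rewrite -/D in DND hDN.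
have [BXB _ hP _] := mpinvP B; rewrite -/(mpproj B) -/P in hP.
have PP : P *m P = P by rewrite /P /mpproj !mulmxA BXB.
have PD : P *m D = D.
  have PDN : P *m (D *m (N *m P)) = D *m (N *m P).
    by rewrite -hDN adjmxM (adjmxM N P) hP (mulmxA P) (mulmxA P P) PP.
  by rewrite -{1}DND mulmxA PDN.
have -> : D *m W *m A *m W *m D = D *m (N *m P) *m D.
  by rewrite /N -{2}PD !mulmxA.
exact: DND.
Qed.

Lemma is_wqBT_unique m n (A : 'M[C]_(m, n)) (W : 'M[C]_(n, m)) q X Y :
  is_wqBT A W q X -> is_wqBT A W q Y -> X = Y.
Proof.
move=> [XNX XWA AWX] [YNY YWA AWY].
rewrite -XNX XWA -YWA -!mulmxA (mulmxA A W X) AWX -AWY -[RHS]YNY.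
by rewrite !mulmxA.
Qed.

Lemma wqBTE m n (A : 'M[C]_(m, n)) (W : 'M[C]_(n, m)) q :
  wqBT A W q = mpinv (W *m A *m W *m mpproj ((A *m W) ^+ q)).
Proof.
have hD := is_wqBT_mpinv A W q.
by apply: (xget_unique 0 hD) => X hX; apply: is_wqBT_unique hX hD.
Qed.

Lemma wqBTP m n (A : 'M[C]_(m, n)) (W : 'M[C]_(n, m)) q :
  is_wqBT A W q (wqBT A W q).
Proof. by rewrite wqBTE; exact: is_wqBT_mpinv. Qed.

Lemma wqBT_unique m n (A : 'M[C]_(m, n)) (W : 'M[C]_(n, m)) q X :
  is_wqBT A W q X -> wqBT A W q = X.
Proof. by move=> hX; apply: is_wqBT_unique hX; exact: wqBTP. Qed.

End Defs.

(* Main.v *)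
Require Import Defs.
From HB Require Import structures.
From mathcomp Require Import all_boot all_order all_algebra.
From mathcomp Require Import spectral.
From mathcomp Require Import reals complex.

(** The unitary factors pass through products, powers and Moore-Penrose
    inverses, so everything reduces to block upper triangular matrices with a
    nonsingular top left corner.

    For such a matrix T = [N, L; 0, B] put F = L (1 - B^+ B), the part of L
    acting on the kernel of B.  Adding to the top right block of T the multiple
    - L B^+ of its second block row leaves [N, F; 0, B], whose two block rows
    have mutually orthogonal row spaces.  The top one is right invertible
    because N is, so its Moore-Penrose inverse is its adjoint times the inverse
    of its Gram matrix N N^* + F F^*.  Combining it with B^+ inverts
    [N, F; 0, B], with projector diag(1, B B^+).  This projector commutes with
    the row operation, because B^+ B B^+ = B^+, so undoing the row operation
    gives T^+ ([mpinv_block_upper]) and leaves T T^+ = diag(1, B B^+)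
    ([mpproj_block_upper]).

    That projector formula turns the projector of (A W)^q into diag(1, Q), with
    Q the projector of (A3 W3)^q, hence W A W P into [N, M Q; 0, W3 A3 W3 Q].
    The Moore-Penrose inverse of W3 A3 W3 Q is X3, and Q X3 = X3
    ([mpinv_mul_proj]), whence M Q X3 = M X3 and M Q (1 - X3 W3 A3 W3 Q) = M E
    for the Hermitian idempotent E = Q - P_X3.  Then [mpinv_block_upper]
    is the claimed formula. *)

Set Implicit Arguments.
Unset Strict Implicit.
Unset Printing Implicit Defensive.

Import Order.TTheory GRing.Theory Num.Theory.
Local Open Scope ring_scope.
Local Open Scope sesquilinear_scope.

(** * Moore-Penrose inverses and projectors *)

Section MoorePenrose.
Variable C : numClosedFieldType.

Lemma adjmxD m n (A B : 'M[C]_(m, n)) : (A + B)^t* = A^t* + B^t*.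
Proof. by rewrite linearD map_mxD. Qed.

Lemma adjmxB m n (A B : 'M[C]_(m, n)) : (A - B)^t* = A^t* - B^t*.
Proof. by rewrite linearB map_mxB. Qed.

Lemma adjmx1 n : (1%:M : 'M[C]_n)^t* = 1%:M.
Proof. by rewrite trmx1 map_mx1. Qed.

Lemma adj_block_mx m1 m2 n1 n2 (A : 'M[C]_(m1, n1)) (B : 'M[C]_(m1, n2))
    (D : 'M[C]_(m2, n1)) (E : 'M[C]_(m2, n2)) :
  (block_mx A B D E)^t* = block_mx (A^t*) (D^t*) (B^t*) (E^t*).
Proof. by rewrite tr_block_mx map_block_mx. Qed.

Lemma unitary_adjmul n (U : 'M[C]_n) : U \is unitarymx -> U^t* *m U = 1%:M.
Proof. by move=> /unitarymxP/mulmx1C. Qed.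

Lemma mpinvK m n (B : 'M[C]_(m, n)) : mpinv (mpinv B) = B.
Proof. by apply: mpinv_unique; have [] := mpinvP B; split. Qed.

Lemma mpproj_mpinv m n (B : 'M[C]_(m, n)) : mpproj (mpinv B) = mpinv B *m B.
Proof. by rewrite /mpproj mpinvK. Qed.

Lemma mpproj_adj m n (B : 'M[C]_(m, n)) : (mpproj B)^t* = mpproj B.
Proof. by have [] := mpinvP B. Qed.

Lemma mpproj_idem m n (B : 'M[C]_(m, n)) : mpproj B *m mpproj B = mpproj B.
Proof. by have [BXB _ _ _] := mpinvP B; rewrite /mpproj mulmxA BXB. Qed.

(** The column space of (B Q)^+ is that of (B Q)^* = Q B^*, which an orthogonal
    projector Q fixes. *)
Lemma mpinv_mul_proj m n (B : 'M[C]_(m, n)) (Q : 'M[C]_n) :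
  Q^t* = Q -> Q *m Q = Q -> Q *m mpinv (B *m Q) = mpinv (B *m Q).
Proof.
move=> hQ QQ; have [_ XDX _ hXD] := mpinvP (B *m Q).
have QD : Q *m (B *m Q)^t* = (B *m Q)^t* by rewrite adjmxM hQ mulmxA QQ.
by rewrite -{1}XDX -hXD adjmxM !mulmxA QD -adjmxM hXD XDX.
Qed.

Lemma mpinv_unitary m n (U : 'M[C]_m) (V : 'M[C]_n) (B : 'M[C]_(n, m)) :
  U \is unitarymx -> V \is unitarymx ->
  mpinv (V *m B *m U^t*) = U *m mpinv B *m V^t*.
Proof.
move=> /unitary_adjmul uU /unitary_adjmul uV; apply: mpinv_unique.
have [BXB XBX hBX hXB] := mpinvP B.
have BX : V *m B *m U^t* *m (U *m mpinv B *m V^t*) = V *m (B *m mpinv B) *m V^t*.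
  by rewrite !mulmxA -(mulmxA _ (U^t*)) uU mulmx1.
have XB : U *m mpinv B *m V^t* *m (V *m B *m U^t*) = U *m (mpinv B *m B) *m U^t*.
  by rewrite !mulmxA -(mulmxA _ (V^t*)) uV mulmx1.
split.
- rewrite BX !mulmxA -(mulmxA _ (V^t*) V) uV mulmx1.
  by rewrite -(mulmxA V B) -(mulmxA V (B *m _)) BXB.
- rewrite XB !mulmxA -(mulmxA _ (U^t*) U) uU mulmx1.
  by rewrite -(mulmxA U (mpinv B)) -(mulmxA U (_ *m B)) XBX.
- by rewrite BX adjmxM [(V *m (_ *m _))^t*]adjmxM trmxCK hBX mulmxA.
- by rewrite XB adjmxM [(U *m (_ *m _))^t*]adjmxM trmxCK hXB mulmxA.
Qed.

Lemma mpproj_unitary n (U : 'M[C]_n) (B : 'M[C]_n) :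
  U \is unitarymx -> mpproj (U *m B *m U^t*) = U *m mpproj B *m U^t*.
Proof.
move=> uU; rewrite /mpproj mpinv_unitary //.
by rewrite !mulmxA -(mulmxA _ (U^t*) U) unitary_adjmul // mulmx1.
Qed.

(** * Block upper triangular matrices *)

(** The sum is the Gram matrix of the block row [N, F], whose rows are
    independent since those of N are. *)
Lemma gramD_unit m n (N : 'M[C]_m) (F : 'M[C]_(m, n)) :
  N \in unitmx -> N *m N^t* + F *m F^t* \in unitmx.
Proof.
move=> uN; have -> : N *m N^t* + F *m F^t* = row_mx N F *m (row_mx N F)^t*.
  by rewrite tr_row_mx map_col_mx mul_row_col.
apply: row_free_gram_unit; rewrite -kermx_eq0.
set K := kermx _; have := mulmx_ker (row_mx N F); rewrite -/K mul_mx_row.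
move=> /eqP; rewrite row_mx_eq0 => /andP[/eqP KN _].
by rewrite -[K](mulmxK uN) KN mul0mx.
Qed.

Section BlockUpper.
Variables (t k l : nat) (N : 'M[C]_t) (L : 'M[C]_(t, l)) (B : 'M[C]_(k, l)).
Hypothesis uN : N \in unitmx.

Let F := L *m (1%:M - mpinv B *m B).
Let Omega := invmx (N *m N^t* + F *m F^t*).
Let T := block_mx N L 0 B.
Let X := block_mx (N^t* *m Omega) (- (N^t* *m Omega *m L *m mpinv B))
           (F^t* *m Omega) (mpinv B - F^t* *m Omega *m L *m mpinv B).

Lemma block_upper_kerE : F^t* = (1%:M - mpinv B *m B) *m L^t*.
Proof. by have [_ _ _ hXB] := mpinvP B; rewrite adjmxM adjmxB adjmx1 hXB. Qed.

(** The rows of F are orthogonal to those of B and are the projections of the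
    rows of L along them. *)
Lemma block_upper_mulF : L *m F^t* = F *m F^t* /\ B *m F^t* = 0.
Proof.
have [BXB XBX _ _] := mpinvP B; split.
  rewrite block_upper_kerE /F; set K := 1%:M - _.
  have KK : K *m K = K.
    by rewrite mulmxBr mulmx1 mulmxBl mul1mx mulmxA XBX subrr subr0.
  by rewrite -(mulmxA L) (mulmxA K) KK.
by rewrite block_upper_kerE mulmxA mulmxBr mulmx1 mulmxA BXB subrr mul0mx.
Qed.

Lemma block_upper_mulTX : T *m X = block_mx 1%:M 0 0 (mpproj B).
Proof.
have [LF BF] := block_upper_mulF.
have Gram_Omega : N *m (N^t* *m Omega) + L *m (F^t* *m Omega) = 1%:M.
  by rewrite !mulmxA LF -mulmxDl mulmxV // gramD_unit.
rewrite mulmx_block; congr block_mx => //.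
- rewrite mulmxN mulmxBr addrCA -opprD.
  rewrite -(mulmxA (_ *m Omega) L) -(mulmxA (F^t* *m Omega) L).
  by rewrite (mulmxA N) (mulmxA L (F^t* *m _)) -mulmxDl Gram_Omega mul1mx subrr.
- by rewrite mul0mx add0r mulmxA BF mul0mx.
- by rewrite mul0mx add0r mulmxBr !mulmxA BF !mul0mx subr0.
Qed.

Lemma block_upper_mulXT :
  X *m T = block_mx (N^t* *m Omega *m N) (N^t* *m Omega *m F)
             (F^t* *m Omega *m N) (F^t* *m Omega *m F + mpinv B *m B).
Proof.
have mulF s (Y : 'M_(s, t)) : Y *m F = Y *m L - Y *m L *m mpinv B *m B.
  by rewrite /F !mulmxBr mulmx1 !mulmxA.
rewrite mulmx_block !mulmx0 !addr0 !mulF; congr block_mx.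
  by rewrite mulNmx.
by rewrite mulmxBl addrCA addrC.
Qed.

Lemma Omega_adj : Omega^t* = Omega.
Proof. by rewrite /Omega adj_invmx adjmxD !adjmxM !trmxCK. Qed.

(** T X is a diagonal projector and X T is visibly Hermitian, so all four
    Moore-Penrose equations follow from those of B. *)
Lemma block_upper_is_mpinv : is_mpinv T X.
Proof.
have [BXB XBX hBX hXB] := mpinvP B.
split.
- rewrite block_upper_mulTX mulmx_block !mul1mx !mul0mx mulmx0 !addr0 !add0r.
  by rewrite /mpproj BXB.
- rewrite -mulmxA block_upper_mulTX mulmx_block !mulmx1 !mulmx0 !addr0 !add0r.
  have XP : mpinv B *m mpproj B = mpinv B by rewrite mulmxA XBX.
  by rewrite mulmxBl mulNmx -!(mulmxA _ (mpinv B)) XP.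
- by rewrite block_upper_mulTX adj_block_mx !trmx0 !map_mx0 adjmx1 hBX.
- rewrite block_upper_mulXT adj_block_mx adjmxD hXB !adjmxM !trmxCK.
  by rewrite !Omega_adj !mulmxA.
Qed.

Lemma mpinv_block_upper : mpinv T = X.
Proof. exact: mpinv_unique block_upper_is_mpinv. Qed.

Lemma mpproj_block_upper : mpproj T = block_mx 1%:M 0 0 (mpproj B).
Proof. by rewrite {1}/mpproj mpinv_block_upper block_upper_mulTX. Qed.

End BlockUpper.

Lemma unitmx_exp n (N : 'M[C]_n) q : N \in unitmx -> N ^+ q \in unitmx.
Proof.
move=> uN; elim: q => [|q IHq]; first by rewrite expr0 unitmx1.
by rewrite exprS unitmx_mul uN.
Qed.

Lemma block_upper_exp t k (N : 'M[C]_t) (L : 'M[C]_(t, k)) (B : 'M[C]_k) q :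
  exists S, (block_mx N L 0 B) ^+ q = block_mx (N ^+ q) S 0 (B ^+ q).
Proof.
elim: q => [|q [S IHq]]; first by exists 0; rewrite !expr0 -scalar_mx_block.
exists (N *m S + L *m B ^+ q).
rewrite !exprS IHq -[LHS]/(_ *m _) mulmx_block !mulmx0 !mul0mx !addr0 !add0r.
by [].
Qed.

Lemma unitary_exp n (U B : 'M[C]_n) q :
  U \is unitarymx -> (U *m B *m U^t*) ^+ q = U *m B ^+ q *m U^t*.
Proof.
move=> uU; elim: q => [|q IHq].
  by rewrite !expr0 mulmx1; have /unitarymxP-> := uU.
rewrite !exprS IHq -[LHS]/(_ *m _) -[B * _]/(B *m _).
by rewrite !mulmxA -(mulmxA _ (U^t*) U) unitary_adjmul // mulmx1.
Qed.

(** A block upper triangular matrix with nonsingular top left corner keeps that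
    shape under powers, so its powers have block diagonal projectors. *)
Lemma mpproj_block_upper_exp t k (U : 'M[C]_(t + k)) (N : 'M[C]_t)
    (L : 'M[C]_(t, k)) (B : 'M[C]_k) q :
  U \is unitarymx -> N \in unitmx ->
  mpproj ((U *m block_mx N L 0 B *m U^t*) ^+ q) =
    U *m block_mx 1%:M 0 0 (mpproj (B ^+ q)) *m U^t*.
Proof.
move=> uU uN; have [S expT] := block_upper_exp N L B q.
by rewrite unitary_exp // expT mpproj_unitary // mpproj_block_upper //
  unitmx_exp.
Qed.

End MoorePenrose.

(** * The weighted q-BT inverse *)

Theorem theorem4p3 (R : realType) (t p r q : nat)
    (A : 'M[R[i]]_(t + p, t + r)) (W : 'M[R[i]]_(t + r, t + p))
    (U : 'M[R[i]]_(t + p)) (V : 'M[R[i]]_(t + r))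
    (A1 : 'M[R[i]]_t) (A2 : 'M[R[i]]_(t, r)) (A3 : 'M[R[i]]_(p, r))
    (W1 : 'M[R[i]]_t) (W2 : 'M[R[i]]_(t, p)) (W3 : 'M[R[i]]_(r, p))
    (W_neq0 : W != 0)
    (decAW : weighted_core_EP A W U V A1 A2 A3 W1 W2 W3) :
  let M := W1 *m A1 *m W2 + W1 *m A2 *m W3 + W2 *m A3 *m W3 in
  let N := W1 *m A1 *m W1 in
  let X3 := wqBT A3 W3 q in
  let E := mpproj ((A3 *m W3) ^+ q) - mpproj X3 in
  let Delta := N *m N^t* + M *m E *m M^t* in
  let Omega := invmx Delta in
  Delta \in unitmx /\
  wqBT A W q =
    U *m block_mx
           (N^t* *m Omega)
           (- (N^t* *m Omega *m M *m X3))
           (E *m M^t* *m Omega)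
           (X3 - E *m M^t* *m Omega *m M *m X3)
      *m V^t*.
Proof.
case: decAW => defA defW [uU uV] [uA1 uW1] _ M N X3 E Delta Omega.
have uN : N \in unitmx by rewrite !unitmx_mul uW1 uA1.
have X3E : X3 = mpinv (W3 *m A3 *m W3 *m mpproj ((A3 *m W3) ^+ q)).
  exact: wqBTE.
have hQ := mpproj_adj ((A3 *m W3) ^+ q).
have QQ := mpproj_idem ((A3 *m W3) ^+ q).
set Q := mpproj ((A3 *m W3) ^+ q) in X3E E Delta Omega hQ QQ *.
have QE : mpproj ((A3 *m W3) ^+ q) = Q by [].
clearbody Q X3.
have [B BE] : exists B, B = W3 *m A3 *m W3 *m Q by exists (W3 *m A3 *m W3 *m Q).
have [L LE] : exists L, L = M *m Q by exists (M *m Q).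
rewrite -BE in X3E.
have QX3 : Q *m X3 = X3 by rewrite X3E BE mpinv_mul_proj.
have LX3 : L *m X3 = M *m X3 by rewrite LE -mulmxA QX3.
have EE : E = Q - X3 *m B by rewrite /E X3E mpproj_mpinv.
(* M E is the block F that [mpinv_block_upper] attaches to [N, L; 0, B] *)
have FE : L *m (1%:M - mpinv B *m B) = M *m E.
  by rewrite -X3E EE !mulmxBr mulmx1 !mulmxA LX3 LE.
have hE : E^t* = E by rewrite adjmxB hQ mpproj_adj.
have E_idem : E *m E = E.
  have QP : Q *m (X3 *m B) = X3 *m B by rewrite mulmxA QX3.
  have PQ : X3 *m B *m Q = X3 *m B by rewrite BE -!mulmxA QQ.
  have PP : X3 *m B *m (X3 *m B) = X3 *m B.
    by rewrite X3E -mpproj_mpinv mpproj_idem.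
  by rewrite EE mulmxBr !mulmxBl QQ QP PQ PP subrr subr0.
have hF : (M *m E)^t* = E *m M^t* by rewrite adjmxM hE.
have DeltaE : Delta = N *m N^t* + (M *m E) *m (M *m E)^t*.
  by rewrite hF !mulmxA -(mulmxA M E E) E_idem.
split; first by rewrite DeltaE gramD_unit.
have defAW : A *m W =
    U *m block_mx (A1 *m W1) (A1 *m W2 + A2 *m W3) 0 (A3 *m W3) *m U^t*.
  have blocks : block_mx A1 A2 0 A3 *m block_mx W1 W2 0 W3 =
      block_mx (A1 *m W1) (A1 *m W2 + A2 *m W3) 0 (A3 *m W3).
    by rewrite mulmx_block !mulmx0 !mul0mx !addr0 !add0r.
  rewrite -blocks defA defW !mulmxA.
  by rewrite -(mulmxA _ (V^t*) V) unitary_adjmul // mulmx1.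
have defWAWP : W *m A *m W *m mpproj ((A *m W) ^+ q) =
    V *m block_mx N L 0 B *m U^t*.
  rewrite -(mulmxA W A) defAW mpproj_block_upper_exp ?unitmx_mul ?uA1 //.
  rewrite QE BE LE.
  have blocks : block_mx W1 W2 0 W3
      *m block_mx (A1 *m W1) (A1 *m W2 + A2 *m W3) 0 (A3 *m W3)
      *m block_mx 1%:M 0 0 Q = block_mx N (M *m Q) 0 (W3 *m A3 *m W3 *m Q).
    rewrite !mulmx_block !mulmx0 !mul0mx !mulmx1 !addr0 !add0r !mulmxA.
    by rewrite mulmxDr !mulmxA.
  rewrite -blocks defW !mulmxA.
  by do 2!rewrite -(mulmxA _ (U^t*) U) (unitary_adjmul uU) mulmx1.
rewrite wqBTE defWAWP mpinv_unitary // mpinv_block_upper // FE -DeltaE -/Omega.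
by rewrite hF -X3E -!(mulmxA _ L X3) LX3 !mulmxA.
Qed.
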